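(* There exist an oracle identification problem, i.e. a sequence $(S_N)_{N=1,2,4,8,\dots}$ in which each $S_N$ (with $N=2^n$) is a set of $M=M_N\ge N$ distinct Boolean functions $f:\{0,1\}^n\to\{0,1\}$, and constants $c>0$ and $N_0$ such that for every $N=2^n\ge N_0$ the bounded-error quantum query complexity $Q(S_N)$ of identifying the input oracle from $S_N$ satisfies $$Q(S_N)\ge c\,\sqrt{\frac{N}{\log N}\,\log M_N}.$$
   Context: Let $N=2^n$; logarithms are base 2. An oracle is a Boolean function $f:\{0,1\}^n\to\{0,1\}$. The oracle identification problem (OIP) for a set $S$ of $M$ distinct oracles: the set $S$ is completely known, an unknown $f\in S$ (the input oracle) is given as a black box, and the task is to determine which element of $S$ it is. A quantum algorithm with $t$ queries is a sequence $U_0,O_f,U_1,O_f,\dots,O_f,U_t$ applied to a fixed initial state (with arbitrary finite workspace), followed by a measurement producing the output, where the $U_j$ are arbitrary unitaries independent of $f$ and $O_f$ maps $|x\rangle|b\rangle$ to $(-1)^{b\cdot f(x)}|x\rangle|b\rangle$ for $x\in\{0,1\}^n$, $b\in\{0,1\}$ (identity on the rest of the workspace). It solves the OIP for $S$ with bounded error if for every $f\in S$, when run with $O_f$, it outputs (the index of) $f$ with probability at least $2/3$. $Q(S)$ is the minimum $t$ for which such an algorithm exists. *)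

(* Defs.v *)
From HB Require Import structures.
From mathcomp Require Import all_boot all_order all_fingroup all_algebra.
From mathcomp Require Import spectral complex.
From mathcomp Require Import boolp reals exp.

Set Implicit Arguments.
Unset Strict Implicit.
Unset Printing Implicit Defensive.

Import Order.TTheory GRing.Theory Num.Theory.
Local Open Scope ring_scope.
Local Open Scope sesquilinear_scope.
Local Open Scope complex_scope.

Definition log2 {R : realType} (x : R) : R := ln x / ln 2.

Definition oracle (n : nat) := {ffun n.-tuple bool -> bool}.

(* Labels of the computational basis |x>|b>|w>, w ranging over the workspace.
   The state space is 'cV[R[i]]_#|basis n W|: coordinate [i] of a vector is
   its amplitude on the basis label [enum_val i]. *)
Definition basis (n : nat) (W : finType) : finType :=
  (n.-tuple bool * bool * W)%type.

Definition query_mx (R : realType) (n : nat) (W : finType) (f : oracle n) :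
    'M[R[i]]_#|basis n W| :=
  diag_mx (\row_i let: (x, b, _) := enum_val i in (-1) ^+ (b && f x)).

Definition sqnorm (R : realType) (d : nat) (v : 'cV[R[i]]_d) : R[i] :=
  \sum_i `|v i 0| ^+ 2.

(* The output is produced by an arbitrary quantum measurement, given by
   measurement operators [meas g], g ranging over the possible outputs, with
   completeness relation sum_g (meas g)^* (meas g) = 1. When the algorithm is
   run with t queries only the unitaries [unitary 0 .. unitary t] are used. *)
Record qalgorithm (R : realType) (n : nat) := QAlgorithm {
  workspace : finType;
  init : 'cV[R[i]]_#|basis n workspace|;
  unitary : nat -> 'M[R[i]]_#|basis n workspace|;
  meas : oracle n -> 'M[R[i]]_#|basis n workspace|;
  init_normalized : sqnorm init = 1;
  unitary_unitary : forall j, unitary j \is unitarymx;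
  meas_complete : \sum_g (meas g)^t* *m meas g = 1%:M }.

Fixpoint state_after (R : realType) (n : nat) (A : qalgorithm R n)
    (f : oracle n) (t : nat) : 'cV[R[i]]_#|basis n (workspace A)| :=
  match t with
  | 0 => unitary A 0 *m init A
  | t'.+1 => unitary A t'.+1 *m (query_mx R (workspace A) f *m state_after A f t')
  end.

(* Born rule: probability that [A], run with [t] queries to [f], outputs [g];
   it is a nonnegative real element of R[i]. *)
Definition output_prob (R : realType) (n : nat) (A : qalgorithm R n)
    (t : nat) (f g : oracle n) : R[i] :=
  sqnorm (meas A g *m state_after A f t).

Definition identifies (R : realType) (n : nat) (A : qalgorithm R n) (t : nat)
    (S : {set oracle n}) : Prop :=
  forall f, f \in S -> 2 / 3 <= output_prob A t f f.

Definition solvable_with (R : realType) (n : nat) (S : {set oracle n})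
    (t : nat) : Prop :=
  exists A : qalgorithm R n, identifies A t S.

(* Every oracle is identified exactly with 2 ^ n queries: the workspace is a
   truth table, filled in one point per query by the circuit "Hadamard on b,
   query, Hadamard on b, swap b with the table entry". This makes the minimum
   in [query_complexity] well defined. *)
Module Exhaustive.

Definition perm_op (R : realType) (B : finType) (g : {perm B}) :
    'M[R[i]]_#|B| := \matrix_(i, j) (enum_val i == g (enum_val j))%:R.

Definition ket (R : realType) (B : finType) (b : B) : 'cV[R[i]]_#|B| :=
  \col_i (enum_val i == b)%:R.

Lemma mul_ket (R : realType) (B : finType) m (M : 'M[R[i]]_(m, #|B|)) b :
  M *m ket R b = col (enum_rank b) M.
Proof.
apply/colP=> i; rewrite !mxE (bigD1 (enum_rank b)) //= !mxE enum_rankK eqxx.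
rewrite mulr1 big1 ?addr0 // => j jb; rewrite mxE.
case: eqP => [e|]; last by rewrite mulr0.
by move: jb; rewrite -e enum_valK eqxx.
Qed.

Lemma ket_ext (R : realType) (B : finType) m (M M' : 'M[R[i]]_(m, #|B|)) :
  (forall b, M *m ket R b = M' *m ket R b) -> M = M'.
Proof.
move=> e; apply/matrixP => i j; have := e (enum_val j).
by rewrite !mul_ket enum_valK => /colP/(_ i); rewrite !mxE.
Qed.

Lemma perm_op_ket (R : realType) (B : finType) (g : {perm B}) b :
  perm_op R g *m ket R b = ket R (g b).
Proof. by rewrite mul_ket; apply/colP=> i; rewrite !mxE enum_rankK. Qed.

Lemma perm_op_adj (R : realType) (B : finType) (g : {perm B}) :
  (perm_op R g)^t* = perm_op R g^-1%g.
Proof.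
apply/matrixP=> i j; rewrite !mxE conjC_nat; congr (_%:R); congr nat_of_bool.
by apply/eqP/eqP => ->; rewrite ?permK ?permKV.
Qed.

Lemma perm_op_unitary (R : realType) (B : finType) (g : {perm B}) :
  perm_op R g \is unitarymx.
Proof.
apply/unitarymxP; rewrite perm_op_adj; apply: ket_ext => b.
by rewrite -mulmxA !perm_op_ket permKV mul1mx.
Qed.

Definition sign_op (R : realType) (B : finType) (s : B -> bool) :
  'M[R[i]]_#|B| := diag_mx (\row_i (-1) ^+ s (enum_val i)).

Lemma sign_op_ket (R : realType) (B : finType) (s : B -> bool) b :
  sign_op R s *m ket R b = (-1) ^+ s b *: ket R b.
Proof.
apply/colP=> i; rewrite mul_diag_mx !mxE.
by case: eqP => [->//|_]; rewrite !mulr0.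
Qed.

Lemma sign_op_adj (R : realType) (B : finType) (s : B -> bool) :
  (sign_op R s)^t* = sign_op R s.
Proof.
apply/matrixP=> i j; rewrite !mxE; have [->|_] := eqVneq j i.
  by rewrite !mulr1n rmorphXn rmorphN rmorph1.
by rewrite !mulr0n rmorph0.
Qed.

Section Circuit.
Context (R : realType) (n : nat).
Let X := n.-tuple bool.
Let B : finType := basis n (oracle n).

Definition flip (a : B) : B := (a.1.1, ~~ a.1.2, a.2).
Lemma flipK : involutive flip.
Proof. by case=> -[x b] r; rewrite /flip /= negbK. Qed.
Definition flip_perm := perm (inv_inj flipK).

Definition hadamard : 'M[R[i]]_#|B| :=
  sqrtC 2^-1 *: (sign_op R (fun a : B => a.1.2) + perm_op R flip_perm).

Lemma hadamard_ket (a : B) : hadamard *m ket R a =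
  sqrtC 2^-1 *: ((-1) ^+ a.1.2 *: ket R a + ket R (flip a)).
Proof. by rewrite -scalemxAl mulmxDl sign_op_ket perm_op_ket permE. Qed.

Lemma hadamard_query (f : oracle n) (x : X) (r : oracle n) :
  query_mx R (oracle n) f *m (hadamard *m ket R ((x, false, r) : B)) =
  hadamard *m ket R ((x, f x, r) : B).
Proof.
have -> : query_mx R (oracle n) f =
    sign_op R (fun a : B => a.1.2 && f a.1.1).
  by congr diag_mx; apply/rowP=> i; rewrite !mxE; case: (enum_val i) => -[].
rewrite !hadamard_ket -scalemxAr mulmxDr -scalemxAr !sign_op_ket /flip /=.
case: (f x); move: (ket _ _) (ket _ _) => u v /=.
  by rewrite !expr0 !expr1 !scale1r addrC.
by rewrite !expr0 !scale1r.
Qed.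

Lemma hadamard_sq : hadamard *m hadamard = 1%:M.
Proof.
apply: ket_ext => -[[x b] r]; rewrite -mulmxA hadamard_ket mul1mx /flip /=.
rewrite -scalemxAr mulmxDr -scalemxAr !hadamard_ket /flip /= negbK.
have ss : sqrtC 2^-1 * sqrtC 2^-1 = 2^-1 :> R[i] by rewrite -expr2 sqrtCK.
rewrite !scalerA mulrC -scalerA -scalerDr scalerA ss.
apply: (@scalerI _ _ (2 : R[i])); first by rewrite pnatr_eq0.
rewrite scalerA mulfV ?pnatr_eq0 // scale1r scaler_nat mulr2n.
case: b; move: (ket _ _) (ket _ _) => u v /=.
  by rewrite !expr1 !expr0 !scale1r !scaleN1r opprD opprK addrA subrK.
by rewrite !expr1 !expr0 !scale1r !scaleN1r addrA addrK.
Qed.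

Lemma hadamard_unitary : hadamard \is unitarymx.
Proof.
apply/unitarymxP; suff -> : hadamard^t* = hadamard by exact: hadamard_sq.
rewrite /hadamard linearZ /= map_mxZ linearD /= map_mxD.
rewrite sign_op_adj perm_op_adj; congr (_ *: (_ + _)).
  by apply/geC0_conj; rewrite sqrtC_ge0 invr_ge0 ler0n.
congr perm_op; apply/permP=> a; apply: (@perm_inj _ flip_perm).
by rewrite permKV !permE flipK.
Qed.

Definition xs (k : nat) : X := nth [tuple of nseq n false] (enum {: X}) k.

Definition step (k : nat) (a : B) : B :=
  (tperm (xs k) (xs k.+1) a.1.1, a.2 (xs k),
   [ffun y => if y == xs k then a.1.2 else a.2 y]).

Lemma step_inj k : injective (step k).
Proof.
move=> [[x b] r] [[x' b'] r'] [/perm_inj -> /= er /ffunP e].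
have := e (xs k); rewrite !ffunE eqxx => ->; congr (_, _).
apply/ffunP=> y; have := e y; rewrite !ffunE.
by case: eqP => [->|].
Qed.

Definition circuit (k : nat) : 'M[R[i]]_#|B| :=
  if k is k'.+1
  then hadamard *m (perm_op R (perm (@step_inj k')) *m hadamard)
  else hadamard.

Lemma circuit_ket k (a : B) :
  circuit k.+1 *m (hadamard *m ket R a) = hadamard *m ket R (step k a).
Proof.
rewrite mulmxA -[_ *m hadamard]mulmxA -[_ *m _ *m hadamard]mulmxA hadamard_sq.
by rewrite mulmx1 -mulmxA perm_op_ket permE.
Qed.

Definition readout (g : oracle n) : 'M[R[i]]_#|B| :=
  diag_mx (\row_i ((enum_val i : B).2 == g)%:R).

Lemma readout_ket g a : readout g *m ket R a = (a.2 == g)%:R *: ket R a.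
Proof.
apply/colP=> i; rewrite mul_diag_mx !mxE.
by case: (enum_val i =P a) => [->//|_]; rewrite !mulr0.
Qed.

Lemma sqnormE d (v : 'cV[R[i]]_d) : sqnorm v = (v^t* *m v) 0 0.
Proof.
by rewrite mxE; apply: eq_bigr => i _; rewrite !mxE normCKC.
Qed.

Lemma sqnorm_ket (a : B) : sqnorm (ket R a) = 1.
Proof.
rewrite /sqnorm (bigD1 (enum_rank a)) //= mxE enum_rankK eqxx normr1 expr1n.
rewrite big1 ?addr0 // => j ja; rewrite mxE.
case: eqP => [e|]; last by rewrite normr0 expr0n.
by move: ja; rewrite -e enum_valK eqxx.
Qed.

Lemma sqnorm_unitary (d : nat) (U : 'M[R[i]]_d) (v : 'cV[R[i]]_d) :
  U \is unitarymx -> sqnorm (U *m v) = sqnorm v.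
Proof.
move=> Uu; rewrite !sqnormE trmx_mul map_mxM -mulmxA (mulmxA _ U).
suff -> : U^t* *m U = 1%:M by rewrite mul1mx.
by apply: mulmx1C; apply/unitarymxP.
Qed.

Lemma circuit_unitary k : circuit k \is unitarymx.
Proof.
case: k => [|k] /=; first exact: hadamard_unitary.
apply: mul_unitarymx; first exact: hadamard_unitary.
by apply: mul_unitarymx; [exact: perm_op_unitary|exact: hadamard_unitary].
Qed.

Lemma readout_complete : \sum_g (readout g)^t* *m readout g = 1%:M.
Proof.
apply: ket_ext => a; rewrite mulmx_suml mul1mx (bigD1 a.2) //=.
have adj g : (readout g)^t* = readout g.
  apply/matrixP=> i j; rewrite !mxE; have [->|_] := eqVneq j i.
    by rewrite !mulr1n conjC_nat.
  by rewrite !mulr0n rmorph0.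
rewrite adj -mulmxA !readout_ket eqxx !scale1r readout_ket eqxx scale1r.
rewrite big1 ?addr0 // => g ga; rewrite -mulmxA readout_ket.
by rewrite eq_sym (negbTE ga) scale0r mulmx0.
Qed.

Definition algorithm : qalgorithm R n :=
  @QAlgorithm R n (oracle n) (ket R ((xs 0, false, [ffun=> false]) : B))
    circuit readout (sqnorm_ket _) circuit_unitary readout_complete.

Definition table (f : oracle n) (k : nat) : oracle n :=
  [ffun y => f y && (y \in take k (enum {: X}))].

Lemma algorithm_state f k : (k <= #|{: X}|)%N ->
  state_after algorithm f k =
  hadamard *m ket R ((xs k, false, table f k) : B).
Proof.
elim: k => [_|k IH lek] /=.
  suff -> : table f 0 = [ffun=> false] by [].
  by apply/ffunP=> y; rewrite !ffunE take0 andbF.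
have sz : (k < size (enum {: X}))%N by rewrite -cardE.
rewrite (IH (ltnW lek)) hadamard_query.
transitivity (hadamard *m ket R (step k ((xs k, f (xs k), table f k) : B))).
  exact: circuit_ket.
rewrite /step /=.
have tk : take k.+1 (enum {: X}) = rcons (take k (enum {: X})) (xs k).
  by rewrite (take_nth [tuple of nseq n false]).
have nk : xs k \notin take k (enum {: X}).
  have : uniq (take k.+1 (enum {: X})) by rewrite take_uniq // enum_uniq.
  by rewrite tk rcons_uniq => /andP[].
congr (_ *m ket R (_, _, _)); first by rewrite tpermL.
  by rewrite ffunE (negbTE nk) andbF.
apply/ffunP=> y; rewrite !ffunE tk mem_rcons inE.
by case: eqP => [->|_] //=; rewrite andbT.
Qed.

Lemma algorithm_correct f : output_prob algorithm #|{: X}| f f = 1.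
Proof.
rewrite /output_prob algorithm_state //.
have -> : table f #|{: X}| = f.
  apply/ffunP=> y; rewrite ffunE take_oversize; last by rewrite -cardE.
  by rewrite mem_enum andbT.
have -> : forall x b, meas algorithm f *m (hadamard *m ket R ((x, b, f) : B)) =
    hadamard *m ket R ((x, b, f) : B).
  move=> x b; rewrite hadamard_ket -scalemxAr mulmxDr -scalemxAr.
  by rewrite !readout_ket /= eqxx !scale1r.
by rewrite sqnorm_unitary ?sqnorm_ket // hadamard_unitary.
Qed.

End Circuit.
End Exhaustive.

Lemma ex_solvable_with (R : realType) (n : nat) (S : {set oracle n}) :
  exists t, `[< solvable_with R S t >].
Proof.
exists #|{: n.-tuple bool}|; apply/asboolP; exists (Exhaustive.algorithm R n).
move=> f _; rewrite Exhaustive.algorithm_correct.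
by rewrite ler_pdivrMr ?ltr0n // mul1r ler_nat.
Qed.

Definition query_complexity (R : realType) (n : nat) (S : {set oracle n}) :
  nat := ex_minn (ex_solvable_with R S).

(* Main.v *)
(* Take S_N to be the N point functions, so that M_N = N and the bound to prove
   is Omega(sqrt N). This is the hybrid argument for unstructured search: let
   phi_k and psi_k^y be the states after k queries to the zero oracle and to
   the point function at y. One query to the point function differs from the
   identity only on the labels |y>|1>, and these are disjoint for distinct y, so
   E_k = \sum_y |psi_k^y - phi_k|^2 satisfies
   E_(k+1) <= (1 + 1/k) E_k + 4 (k + 1), hence E_t <= 4 t^2. On the other hand
   phi_t does not depend on y and all outputs together have probability 1, which
   forces 2N/3 <= 2 + 2 E_t. *)
Require Import Defs.
From mathcomp Require Import all_boot all_order all_algebra.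
From mathcomp Require Import spectral complex.
From mathcomp Require Import boolp reals exp.
From mathcomp Require Import ring zify.

Import Order.TTheory GRing.Theory Num.Theory.
Local Open Scope ring_scope.
Local Open Scope sesquilinear_scope.
Local Open Scope complex_scope.

(** The two sides differ by [|x - k y|^2]. This is the weighted inequality with factors 1 + 1/k and
    1 + k, multiplied by k to avoid division. *)
Lemma normD_sqr_le (C : numClosedFieldType) (k : nat) (x y : C) :
  k%:R * `|x + y| ^+ 2 <= k.+1%:R * `|x| ^+ 2 + (k * k.+1)%N%:R * `|y| ^+ 2.
Proof.
rewrite -subr_ge0 natrM.
suff -> : k.+1%:R * `|x| ^+ 2 + k%:R * k.+1%:R * `|y| ^+ 2
    - k%:R * `|x + y| ^+ 2 = `|x - k%:R * y| ^+ 2 by rewrite exprn_ge0.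
rewrite !normCK rmorphB rmorphD rmorphM rmorph_nat /= -natr1.
by move: (Num.conj x) (Num.conj y) => x' y'; ring.
Qed.

Section SqNorm.
Context {R : realType}.

Lemma sqnorm_ge0 d (v : 'cV[R[i]]_d) : 0 <= sqnorm v.
Proof. by apply: sumr_ge0 => i _; rewrite exprn_ge0. Qed.

Lemma sqnorm0 d : sqnorm (0 : 'cV[R[i]]_d) = 0.
Proof. by rewrite /sqnorm big1 // => i _; rewrite mxE normr0 expr0n. Qed.

Lemma sqnormD_le d (k : nat) (u v : 'cV[R[i]]_d) :
  k%:R * sqnorm (u + v) <=
  k.+1%:R * sqnorm u + (k * k.+1)%N%:R * sqnorm v.
Proof.
rewrite /sqnorm !mulr_sumr -big_split /=; apply: ler_sum => i _.
by rewrite mxE normD_sqr_le.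
Qed.

Lemma sqnorm_meas_sum {n} (A : qalgorithm R n)
    (v : 'cV[R[i]]_#|basis n (workspace A)|) :
  \sum_g sqnorm (meas A g *m v) = sqnorm v.
Proof.
rewrite (Exhaustive.sqnormE v) -[X in _ *m X]mul1mx -(meas_complete A).
rewrite mulmx_suml mulmx_sumr summxE; apply: eq_bigr => g _.
by rewrite Exhaustive.sqnormE trmx_mul map_mxM !mulmxA.
Qed.

Lemma sqnorm_meas_le {n} (A : qalgorithm R n) g
    (v : 'cV[R[i]]_#|basis n (workspace A)|) :
  sqnorm (meas A g *m v) <= sqnorm v.
Proof.
rewrite -(sqnorm_meas_sum A v) (bigD1 g) //= lerDl.
by apply: sumr_ge0 => h _; exact: sqnorm_ge0.
Qed.

End SqNorm.

Section Query.
Context {R : realType} {n : nat}.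

Lemma query_mxE (W : finType) (f : oracle n) (v : 'cV[R[i]]_#|basis n W|) i :
  (query_mx R W f *m v) i 0 =
  (-1) ^+ ((enum_val i).1.2 && f (enum_val i).1.1) * v i 0.
Proof. by rewrite mul_diag_mx !mxE; case: (enum_val i) => -[]. Qed.

Lemma sqnorm_query (W : finType) (f : oracle n) (v : 'cV[R[i]]_#|basis n W|) :
  sqnorm (query_mx R W f *m v) = sqnorm v.
Proof.
by apply: eq_bigr => i _; rewrite query_mxE normrM normrX normrN1 expr1n mul1r.
Qed.

Lemma sqnorm_state_after (A : qalgorithm R n) (f : oracle n) t :
  sqnorm (state_after A f t) = 1.
Proof.
elim: t => [|t IH] /=; rewrite Exhaustive.sqnorm_unitary ?unitary_unitary //.
  exact: init_normalized.
by rewrite sqnorm_query.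
Qed.

Definition zero_oracle : oracle n := [ffun=> false].
Definition point_oracle (y : n.-tuple bool) : oracle n := [ffun x => x == y].

Lemma point_oracle_inj : injective point_oracle.
Proof.
by move=> y z /ffunP/(_ y); rewrite !ffunE eqxx => /esym/eqP.
Qed.

Definition point_oracles : {set oracle n} :=
  [set point_oracle y | y : n.-tuple bool].

Lemma card_point_oracles : #|point_oracles| = (2 ^ n)%N.
Proof.
by rewrite card_imset ?card_tuple ?card_bool //; exact: point_oracle_inj.
Qed.

Lemma query_zero (W : finType) (v : 'cV[R[i]]_#|basis n W|) :
  query_mx R W zero_oracle *m v = v.
Proof.
by apply/colP=> i; rewrite query_mxE ffunE andbF expr0 mul1r.
Qed.

(** After exchanging the sums, coordinate [i] is altered only by the [y] equal to its own query
    point, and there by a factor 0 or -2, whence 4. *)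
Lemma sum_sqnorm_query_sub (W : finType) (v : 'cV[R[i]]_#|basis n W|) :
  \sum_y sqnorm (query_mx R W (point_oracle y) *m v - v) <= 4 * sqnorm v.
Proof.
rewrite /sqnorm exchange_big mulr_sumr /=; apply: ler_sum => i _.
have E y : (query_mx R W (point_oracle y) *m v - v) i 0 =
    ((-1) ^+ ((enum_val i).1.2 && ((enum_val i).1.1 == y)) - 1) * v i 0.
  by rewrite mxE query_mxE ffunE mxE mulrBl mul1r.
rewrite (bigD1 (enum_val i).1.1) //= big1 => [|y ne]; last first.
  by rewrite E eq_sym (negbTE ne) andbF expr0 subrr mul0r normr0 expr0n.
rewrite addr0 E eqxx andbT normrM exprMn ler_wpM2r ?exprn_ge0 //.
case: (enum_val i).1.2; last by rewrite subrr normr0 expr0n.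
by rewrite expr1 -opprD normrN -[1 + 1]/(2%:R) normr_nat -natrX.
Qed.

Context (A : qalgorithm R n).
Let phi t := state_after A zero_oracle t.
Let psi y t := state_after A (point_oracle y) t.

Lemma hybrid_bound t :
  \sum_y sqnorm (psi y t - phi t) <= (4 * t ^ 2)%N%:R.
Proof.
elim: t => [|t IH].
  by rewrite big1 // => y _; rewrite /psi /phi /= subrr sqnorm0.
pose a y := psi y t - phi t.
pose q y := query_mx R (workspace A) (point_oracle y).
pose b y := q y *m phi t - phi t.
(* The zero oracle acts as the identity, so the new difference splits into the old one, moved
   isometrically by [q y], and the fresh error [b y]. *)
have step y : sqnorm (psi y t.+1 - phi t.+1) = sqnorm (q y *m a y + b y).
  rewrite /psi /phi /= query_zero -mulmxBr Exhaustive.sqnorm_unitary.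
    by rewrite /a /b mulmxBr addrA subrK.
  exact: unitary_unitary.
have b_le : \sum_y sqnorm (b y) <= 4.
  by rewrite (le_trans (sum_sqnorm_query_sub _ _)) // sqnorm_state_after mulr1.
rewrite (eq_bigr _ (fun y _ => step y)).
(* The weight k = t is useless at t = 0; there the old difference vanishes and [b_le] alone
   suffices. *)
case: t => [|t] in a b step b_le IH *.
  rewrite (eq_bigr (fun y => sqnorm (b y))) // => y _.
  by rewrite /a /psi /phi /= subrr mulmx0 add0r.
rewrite -(ler_pM2l (ltr0Sn _ t)) mulr_sumr.
apply: (@le_trans _ _ (t.+2%:R * \sum_y sqnorm (a y)
    + (t.+1 * t.+2)%N%:R * \sum_y sqnorm (b y))).
  rewrite !mulr_sumr -big_split /=; apply: ler_sum => y _.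
  by rewrite -(sqnorm_query _ (point_oracle y) (a y)); exact: sqnormD_le.
apply: le_trans (lerD (ler_wpM2l (ler0n _ _) IH) (ler_wpM2l (ler0n _ _) b_le)) _.
(* With k = [t.+1] this is the equality 4k^2(k+1) + 4k(k+1) = 4k(k+1)^2. *)
by rewrite -!natrM -natrD ler_nat; nia.
Qed.

Lemma point_oracles_query_bound t :
  identifies A t point_oracles -> (2 ^ n <= 3 + 12 * t ^ 2)%N.
Proof.
move=> idA.
(* Point functions are distinct outputs of one and the same run, on the zero oracle, so their
   probabilities add up to at most 1. *)
have phi_le : \sum_y sqnorm (meas A (point_oracle y) *m phi t) <= 1.
  rewrite -(sqnorm_state_after A zero_oracle t) -(sqnorm_meas_sum A).
  rewrite [leRHS](bigID (mem point_oracles)) /= big_imset /=; last first.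
    by move=> y z _ _; exact: point_oracle_inj.
  by rewrite lerDl; apply: sumr_ge0 => g _; exact: sqnorm_ge0.
(* Write [psi] as [phi] plus the difference; weight k = 1 gives both factors 2. *)
have pt y : 2 / 3 <= 2 * sqnorm (meas A (point_oracle y) *m phi t)
    + 2 * sqnorm (psi y t - phi t).
  apply: le_trans (idA _ (imset_f _ isT)) _; rewrite /output_prob -/(psi y t).
  have := sqnormD_le _ 1 (meas A (point_oracle y) *m phi t)
    (meas A (point_oracle y) *m (psi y t - phi t)).
  rewrite -mulmxDr addrC subrK !mul1r => /le_trans; apply.
  by rewrite lerD2l mul1n ler_wpM2l // sqnorm_meas_le.
have := ler_sum (P := xpredT) (index_enum _) (fun y _ => pt y).
rewrite sumr_const card_tuple card_bool big_split -!mulr_sumr /= => le1.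
have {le1} := le_trans le1 (lerD (ler_wpM2l (ler0n _ 2) phi_le)
   (ler_wpM2l (ler0n _ 2) (hybrid_bound t))).
rewrite -[_ / _ *+ _]mulr_natr mulrAC ler_pdivrMr ?ltr0n // mulr1.
by rewrite -!natrM -natrD -natrM ler_nat; nia.
Qed.

End Query.

Theorem theorem2 (R : realType) :
  exists (S : forall n : nat, {set oracle n}) (c : R) (N0 : nat),
    [/\ 0 < c,
        forall n : nat, (2 ^ n <= #|S n|)%N
      & forall n : nat, (N0 <= 2 ^ n)%N ->
          c * Num.sqrt ((2 ^ n)%N%:R / log2 (2 ^ n)%N%:R * log2 #|S n|%:R)
            <= (query_complexity R (S n))%:R].
Proof.
(* N >= 4 makes log N nonzero and excludes t = 0 in N <= 3 + 12t^2; for t >= 1 that bound is at most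
   16t^2, whence the constant 1/4. *)
exists (@point_oracles), 4^-1, 4%N; split=> [|n|n le4N].
- by rewrite invr_gt0 ltr0n.
- by rewrite card_point_oracles.
rewrite card_point_oracles mulfVK; last first.
  rewrite /log2 mulf_neq0 ?invr_neq0 // gt_eqF // ln_gt0 // ltr1n //.
  exact: leq_trans le4N.
rewrite /query_complexity; case: ex_minnP => t /asboolP[A idA] _.
have := point_oracles_query_bound _ _ idA => leN.
have {}leN : (2 ^ n <= (4 * t) ^ 2)%N.
  by case: t => [|t] in idA leN *; nia.
rewrite mulrC ler_pdivrMr ?ltr0n // mulrC -natrM.
rewrite -[leRHS]ger0_norm ?ler0n // -sqrtr_sqr ler_wsqrtr //.
by rewrite -natrX ler_nat.
Qed.
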